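(* For every $k\ge2$ there is a graph $G$ with $\mathrm{ctdw}(G)\le2$ and $\mathrm{cstw}(G)\ge k$.
   Context: A strong tree decomposition of $G=(V,E)$ is $(\{X_i\}_{i\in I},T=(I,F))$ where $\{X_i\}$ partitions $V$ and $T$ is a tree such that each edge has both ends in one bag or in bags of two adjacent tree nodes; its width is the maximum bag size. $\mathrm{cstw}(G)$ (connected strong tree width) is the minimum width of a strong tree decomposition in which each bag induces a connected subgraph. A tree distance decomposition is a strong tree decomposition with root $r$ such that each $v\in X_i$, $i\neq r$, has a neighbor in the bag of the parent of $i$; $\mathrm{ctdw}(G)$ (root-connected tree distance width) is the minimum width of a tree distance decomposition whose root bag induces a connected subgraph. *)

(* Defs.v *)
From mathcomp Require Import all_boot.

Set Implicit Arguments.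
Unset Strict Implicit.
Unset Printing Implicit Defensive.

Record sgraph := SGraph {
  vertex :> finType;
  adj : rel vertex;
  adj_sym : symmetric adj;
  adj_irr : irreflexive adj }.

(* The subgraph induced by S is connected (set0 counts as connected). *)
Definition connected_in (G : sgraph) (S : {set G}) : Prop :=
  {in S &, forall x y,
    connect [rel u v | [&& u \in S, v \in S & adj u v]] x y}.

Definition is_tree (T : sgraph) : Prop :=
  [/\ 0 < #|T|,
      connected_in [set: T]
    & forall c : seq T, 2 < size c -> ~~ ucycleb (@adj T) c].

(* Parts of a [partition] are nonempty; together with injectivity this says *)
(* that the indexed family of bags partitions the vertex set.               *)
Record strong_tree_decomp (G : sgraph) := StrongTreeDecomp {
  dtree : sgraph;
  bag : dtree -> {set G};
  dtreeP : is_tree dtree;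
  bag_inj : injective bag;
  bag_partition : partition [set bag i | i : dtree] [set: G];
  bag_edge : forall u v : G, adj u v ->
    exists i j, [/\ u \in bag i, v \in bag j & (i == j) || adj i j] }.

Definition width (G : sgraph) (D : strong_tree_decomp G) : nat :=
  \max_(i : dtree D) #|bag i|.

(* p is the last vertex before i on a simple path from r to i; in a tree    *)
(* such a p exists and is unique for every i != r, and there is none for r. *)
Definition is_parent (T : sgraph) (r p i : T) : Prop :=
  exists s : seq T,
    [/\ path (@adj T) r (rcons s i), uniq (r :: rcons s i) & last r s = p].

Definition tree_distance (G : sgraph) (D : strong_tree_decomp G)
    (r : dtree D) : Prop :=
  forall i : dtree D, i != r ->
    exists2 p, is_parent r p i
             & forall v, v \in bag i -> exists2 u, u \in bag p & adj v u.

Definition is_minimum (P : nat -> Prop) (m : nat) : Prop :=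
  P m /\ forall n, P n -> m <= n.

(* The graph parameters are rendered as relations, stating that the         *)
(* parameter of G is defined and equals w: root-connected tree distance     *)
(* decompositions exist only for connected graphs.                          *)
Definition is_cstw (G : sgraph) (w : nat) : Prop :=
  is_minimum
    (fun n => exists D : strong_tree_decomp G,
       (forall i : dtree D, connected_in (bag i)) /\ width D = n) w.

Definition is_ctdw (G : sgraph) (w : nat) : Prop :=
  is_minimum
    (fun n => exists (D : strong_tree_decomp G) (r : dtree D),
       [/\ tree_distance r, connected_in (bag r) & width D = n]) w.

(* Main.v *)
(* The graph is a cycle of length 2k.  Its distance layers around a vertex have *)
(* at most two elements and form a path.  Conversely, removing a connected set  *)
(* from a cycle leaves a connected set, so a decomposition tree with connected  *)
(* bags has no cut vertex, hence at most two nodes, and one of at most two bags *)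
(* contains at least k vertices.                                                *)
Require Import Defs.
From mathcomp Require Import all_boot.
From mathcomp Require Import zify.
From Stdlib Require Import Classical.

Set Implicit Arguments.
Unset Strict Implicit.
Unset Printing Implicit Defensive.

(** A strong tree decomposition amounts to a map from the graph onto a tree that sends each edge to
    an edge or to a single node ([decomp_node_map], [decomp_of_map]). For the upper bound the map is
    the distance to vertex 0, with a path as tree ([cycle_distance_decomp]). For the lower bound, a
    tree minus a node is the image of the complement of a bag, and in a cycle the complement of a
    connected set is connected ([cycle_graph_setC_connected]). A tree without cut vertex has at most
    two nodes ([tree_without_cut_vertex]), so some bag holds half of the vertices. Since the
    parameters are relations, their values must be shown to exist; [is_minimum_below] extracts them
    from any one decomposition. *)

Lemma is_minimum_below (P : nat -> Prop) (n : nat) :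
  P n -> exists2 m, is_minimum P m & m <= n.
Proof.
elim/ltn_ind: n => n IH Pn.
case: (classic (exists2 m, P m & m < n)) => [[m Pm lt_mn]|no_smaller].
  have [w Pw le_wm] := IH m lt_mn Pm.
  by exists w => //; apply: leq_trans le_wm (ltnW lt_mn).
exists n => //; split=> // m Pm; rewrite leqNgt; apply/negP => lt_mn.
by apply: no_smaller; exists m.
Qed.

(** The hypothesis asks only for [connect] in the target, so that [f] may collapse an edge, as
    happens to edges inside one bag. *)
Lemma homo_connect (V W : finType) (e : rel V) (e' : rel W) (f : V -> W) :
  (forall x y, e x y -> connect e' (f x) (f y)) ->
  forall x y, connect e x y -> connect e' (f x) (f y).
Proof.
move=> fe x y /connectP[p]; elim: p x => [|z p IH] x /=; first by move=> _ ->.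
by case/andP=> exz pz ey; apply: connect_trans (fe _ _ exz) (IH _ pz ey).
Qed.

Lemma connect_interval (n : nat) (e : rel 'I_n) (u v : 'I_n) :
  u <= v ->
  (forall x y : 'I_n, u <= x -> y <= v -> x.+1 = y -> e x y) ->
  connect e u v.
Proof.
move: {2}(v - u) (erefl (v - u)) => d; elim: d u => [|d IH] u dE le_uv euv.
  by have -> : u = v by apply: val_inj => /=; lia.
have lt_un : u.+1 < n by have := ltn_ord v; lia.
pose w := Ordinal lt_un.
apply: (@connect_trans _ _ w); first by apply/connect1/euv => //=; lia.
apply: IH => /=; [lia | lia | move=> x y ux yv; apply: euv => //; lia].
Qed.

Lemma connected_in_sym (G : sgraph) (S : {set G}) :
  connect_sym [rel u v | [&& u \in S, v \in S & adj u v]].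
Proof.
by apply: sym_connect_sym => u v /=; rewrite adj_sym andbCA.
Qed.

(** * Paths as rooted trees *)

Definition path_adj (n : nat) : rel 'I_n :=
  fun u v => (u.+1 == v :> nat) || (v.+1 == u :> nat).

Lemma path_adj_sym n : symmetric (@path_adj n).
Proof. by move=> u v; rewrite /path_adj orbC. Qed.

Lemma path_adj_irr n : irreflexive (@path_adj n).
Proof. by move=> u; rewrite /path_adj; lia. Qed.

Definition path_graph n := SGraph (@path_adj_sym n) (@path_adj_irr n).

Lemma path_graph_tree n : is_tree (path_graph n.+1).
Proof.
split; first by rewrite card_ord.
  move=> x y _ _; wlog le_xy : x y / (x : 'I__) <= (y : 'I__).
    move=> H; case: (leqP (x : 'I__) (y : 'I__)) => [|/ltnW]; first exact: H.
    by rewrite connected_in_sym; apply: H.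
  refine (connect_interval le_xy _) => u v _ _ uv.
  by rewrite /= !inE /path_adj uv eqxx.
case=> [//|x0 c0]; set c := x0 :: c0 => size_c; apply/negP => /andP[cyc_c uniq_c].
(* Both neighbours on the cycle of its largest vertex must be the predecessor. *)
have c_x0 : x0 \in c by rewrite mem_head.
case: (@arg_maxnP _ x0 (mem c) (fun i : 'I__ => i) c_x0) => m c_m max_m.
have [i c' rot_c] := rot_to c_m.
have c'_lt x : x \in c' -> (x : 'I__) < (m : 'I__).
  move=> c'x; have := uniq_c; rewrite -(rot_uniq i) rot_c /= => /andP[c'm _].
  have /max_m le_xm : x \in c by rewrite -(mem_rot i) rot_c inE c'x orbT.
  have neq_xm : x != m by apply: contraNneq c'm => <-.
  by rewrite ltn_neqAle; apply/andP.
have size_c' : 1 < size c'.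
  by have := congr1 size rot_c; rewrite size_rot /= => E; rewrite -ltnS -E.
move: cyc_c uniq_c; rewrite -(rot_cycle i) -(rot_uniq i) rot_c.
case: c' {rot_c} c'_lt size_c' => [//|x c'] c'_lt; case: (lastP c') c'_lt => // {}c' y c'_lt _.
rewrite /= rcons_path last_rcons => /and3P[mx _ ym] /and3P[_ c'x _].
have x_lt := c'_lt x (mem_head _ _).
have y_lt : (y : 'I__) < (m : 'I__) by apply: c'_lt; rewrite inE mem_rcons mem_head orbT.
case/negP: c'x; rewrite mem_rcons inE.
suff -> : x = y by rewrite eqxx.
by apply: val_inj; move: mx ym x_lt y_lt; rewrite /path_adj /=; lia.
Qed.

Lemma path_graph_parent n (p i : path_graph n.+1) :
  (p : 'I_n.+1).+1 = (i : 'I_n.+1) :> nat -> @is_parent (path_graph n.+1) ord0 p i.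
Proof.
(* The bound on the entries makes the next vertex fresh, both in the induction and when [i] is
   appended at the end. *)
have [s [path_s uniq_s last_s le_s]] : exists s : seq (path_graph n.+1),
    [/\ path (@adj (path_graph n.+1)) ord0 s, uniq (ord0 :: s), last ord0 s = p
      & {in ord0 :: s, forall x : 'I_n.+1, x <= (p : 'I_n.+1)}].
  case: p => m lt_m; elim: m lt_m => [|m IH] lt_m.
    exists [::]; split=> //=; first exact: val_inj.
    by move=> x; rewrite inE => /eqP->.
  have [s [path_s uniq_s last_s le_s]] := IH (ltnW lt_m).
  exists (rcons s (Ordinal lt_m)); split.
  - by rewrite rcons_path path_s last_s /= /path_adj eqxx.
  - rewrite -rcons_cons rcons_uniq uniq_s andbT.
    by apply/negP => /le_s /=; rewrite ltnn.
  - by rewrite last_rcons.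
  - move=> x; rewrite -rcons_cons mem_rcons inE => /orP[/eqP-> //|/le_s /=].
    exact: leqW.
move=> pi; exists s; split=> //.
  by rewrite rcons_path path_s last_s /= /path_adj pi eqxx.
rewrite -rcons_cons rcons_uniq uniq_s andbT.
by apply/negP => /le_s /=; lia.
Qed.

(** * Cycles and complements of connected sets *)

(** The conjunct [u != v] matters for [n = 1], where the wrap-around clause would create a loop. *)
Definition cycle_adj (n : nat) : rel 'I_n :=
  fun u v => (u != v :> nat) && [|| u.+1 == v :> nat, v.+1 == u :> nat,
    (u == 0 :> nat) && (v.+1 == n) | (v == 0 :> nat) && (u.+1 == n)].

Lemma cycle_adj_sym n : symmetric (@cycle_adj n).
Proof. by move=> u v; rewrite /cycle_adj; lia. Qed.

Lemma cycle_adj_irr n : irreflexive (@cycle_adj n).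
Proof. by move=> u; rewrite /cycle_adj eqxx. Qed.

Definition cycle_graph n := SGraph (@cycle_adj_sym n) (@cycle_adj_irr n).

(** Two vertices outside [B] cut the cycle into two open arcs. Being connected, [B] lies within one
    of them, and the other arc joins the two vertices outside [B]. *)
Lemma cycle_graph_setC_connected n (B : {set cycle_graph n}) :
  connected_in B -> connected_in (~: B).
Proof.
move=> conB u v; wlog lt_uv : u v / (u : 'I_n) < (v : 'I_n).
  move=> H Bu Bv; case: (ltngtP (u : 'I_n) (v : 'I_n)) => [lt|lt|/val_inj ->].
  - exact: H.
  - by rewrite connected_in_sym; apply: H.
  - exact: connect0.
rewrite !in_setC => Bu Bv.
pose inside := [pred x : 'I_n | u < x < v].
case: (boolP [exists b in B, inside b]) => [/existsP[b /andP[Bb in_b]]|]; last first.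
  move=> no_in; refine (connect_interval (ltnW lt_uv) _) => x y ux yv xy.
  have out z : inside z -> z \notin B.
    move=> in_z; apply: contraNN no_in => Bz.
    by apply/existsP; exists z; rewrite Bz.
  have Bz (z : 'I_n) : u <= z -> z <= v -> z \notin B.
    rewrite leq_eqVlt => /orP[/eqP/val_inj <- //|uz].
    rewrite leq_eqVlt => /orP[/eqP/val_inj -> //|zv].
    by apply: out; rewrite /= uz.
  rewrite /= !in_setC !Bz ?andTb /cycle_adj /=; lia.
have out (z : 'I_n) : ~~ (u <= z <= v) -> z \notin B.
  move=> out_z; apply/negP => Bz.
  (* A step within [B] can leave the arc only through [u] or [v], which are not in [B]. *)
  have clos : closed [rel x y | [&& x \in B, y \in B & @adj (cycle_graph n) x y]] inside.
    apply: intro_closed; first exact: connected_in_sym.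
    move=> x y /and3P[Bx By xy] in_x.
    have yu : y != u :> 'I_n by apply: contraNneq Bu => <-.
    have yv : y != v :> 'I_n by apply: contraNneq Bv => <-.
    move: in_x xy yu yv; rewrite !inE /= /cycle_adj -!(inj_eq val_inj) /=.
    by have := ltn_ord (v : 'I_n); lia.
  have := closed_connect clos (conB b z Bb Bz).
  by move: out_z in_b; rewrite !inE /=; lia.
have Bz (z : 'I_n) : (z <= u) || (v <= z) -> z \notin B.
  move=> zuv; case: (z =P u) => [-> //|/eqP zu]; case: (z =P v) => [-> //|/eqP zv].
  by apply: out; move: zuv zu zv; rewrite -!(inj_eq val_inj) /=; lia.
have n_gt0 : 0 < n by have := ltn_ord u; lia.
have lt_last : n.-1 < n by rewrite ltn_predL.
(* The other arc: from [v] up to [n.-1], across to 0, then up to [u]. *)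
rewrite connected_in_sym.
apply: (@connect_trans _ _ (Ordinal lt_last : cycle_graph n)).
  refine (connect_interval _ _) => [|x y ux yv xy] /=; first by have := ltn_ord v; lia.
  rewrite !in_setC !Bz /= ?/cycle_adj /=; lia.
apply: (@connect_trans _ _ (Ordinal n_gt0 : cycle_graph n)).
  by apply: connect1; rewrite /= !in_setC !Bz /= ?/cycle_adj /=; have := ltn_ord v; lia.
refine (connect_interval _ _) => [|x y ux yv xy] //=.
rewrite !in_setC !Bz /= ?/cycle_adj /=; lia.
Qed.

(** * Trees without cut vertices *)

Lemma connected_exit (T : sgraph) (S : {set T}) (a b : T) :
  connected_in [set: T] -> a \in S -> b \notin S ->
  exists x y, [/\ x \in S, y \notin S & adj x y].
Proof.
move=> conT Sa Sb; apply: NNPP => no_exit.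
have clos : closed [rel u v | [&& u \in [set: T], v \in [set: T] & adj u v]] S.
  apply: intro_closed; first exact: connected_in_sym.
  move=> x y /= /and3P[_ _ xy] Sx; apply/negP => /negP Sy.
  by apply: no_exit; exists x, y.
have := closed_connect clos (conT a b (in_setT a) (in_setT b)).
by rewrite Sa (negPf Sb).
Qed.

(** With three or more nodes, some [t] has two distinct neighbours [a] and [b]; a simple path from
    [a] to [b] avoiding [t] closes through [t] into a forbidden cycle. *)
Lemma tree_without_cut_vertex (T : sgraph) :
  is_tree T -> (forall t : T, connected_in (~: [set t])) -> #|T| <= 2.
Proof.
move=> [T_gt0 conT acyclic] no_cut; rewrite leqNgt; apply/negP => T_gt2.
suff [t [a [b [ta tb neq_ab]]]] : exists t a b : T, [/\ adj t a, adj t b & a != b].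
  have neq_adj x : adj t x -> x \in ~: [set t].
    by rewrite in_setC1; apply: contraTneq => ->; rewrite adj_irr.
  have /connectP[p0 path_p0 last_p0] := no_cut t a b (neq_adj a ta) (neq_adj b tb).
  move: last_p0; case/shortenP: path_p0 => p path_p uniq_p _ last_p.
  have p_neq x : x \in a :: p -> x != t.
    rewrite inE => /orP[/eqP->|p_x]; first by have := neq_adj a ta; rewrite in_setC1.
    have {path_p}: path [rel u v | v != t] a p.
      by apply: sub_path path_p => u v /= /and3P[_]; rewrite in_setC1.
    elim: p {uniq_p last_p} a {ta neq_ab} p_x => // y p IH a.
    by rewrite inE /= => /orP[/eqP-> /andP[]|/IH{}IH /andP[_ /IH]].
  have := acyclic (t :: a :: p); case: p path_p uniq_p last_p p_neq => [|y p].
    by move=> _ _ ba; rewrite ba eqxx in neq_ab.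
  move=> path_p uniq_p last_p p_neq /(_ isT)/negP; apply.
  apply/andP; split; last first.
    by rewrite cons_uniq uniq_p andbT; apply/negP => /p_neq; rewrite eqxx.
  rewrite (cycle_path t) /= in last_p *; rewrite -last_p adj_sym tb ta /=.
  by apply: (sub_path _ path_p) => u v /= /and3P[].
have other (S : {set T}) : #|S| <= 2 -> exists c, c \notin S.
  move=> S_le2; apply: NNPP => all_S; have : [set: T] \subset S.
    by apply/subsetP => x _; apply/negP => /negP Sx; apply: all_S; exists x.
  by move/subset_leq_card; rewrite cardsT leqNgt (leq_ltn_trans S_le2).
(* To find [t], take an edge [a b], then an edge leaving [[set a; b]]: its inner end has two
   neighbours. *)
have /card_gt0P[a _] := T_gt0.
have [|b ab] := other [set a]; first by rewrite cards1.
have [_ [{ab}b [/set1P-> ]]] := connected_exit conT (set11 a) ab.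
rewrite in_set1 => neq_ba ab.
have [|c abc] := other [set a; b]; first by rewrite cards2; case: (a != b).
have [x [y [/set2P[]-> Sy xy]]] := connected_exit conT (set21 a b) abc.
  exists a, b, y; split=> //; apply: contraNneq Sy => <-; exact: set22.
exists b, a, y; rewrite adj_sym; split=> //; apply: contraNneq Sy => <-; exact: set21.
Qed.

(** * Lower bound on the width *)

Lemma decomp_node_map (G : sgraph) (D : strong_tree_decomp G) :
  exists f : G -> dtree D, forall u i, (u \in bag i) = (f u == i).
Proof.
have /and3P[/eqP coverD triv _] := bag_partition D.
have node u : exists i : dtree D, u \in bag i.
  have: u \in cover [set bag i | i : dtree D] by rewrite coverD inE.
  by case/bigcupP => _ /imsetP[i _ ->] ui; exists i.
exists (fun u => xchoose (node u)) => u i; have ui := xchooseP (node u).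
(* The partition separates bags only as sets; [bag_inj] turns this into a separation of indices. *)
apply/idP/eqP => [ui'|<- //]; apply: (@bag_inj _ D); apply: contraTeq ui' => neq.
have bag_in (j : dtree D) : bag j \in [set bag i | i : dtree D] by apply: imset_f.
by rewrite (disjointFr (trivIsetP triv _ _ (bag_in _) (bag_in i) neq)).
Qed.

Lemma partition_width (G : sgraph) (D : strong_tree_decomp G) :
  #|G| <= #|dtree D| * width D.
Proof.
rewrite -cardsT (card_partition (bag_partition D)).
apply: (@leq_trans (#|[set bag i | i : dtree D]| * width D)).
  rewrite -sum_nat_const; apply: leq_sum => _ /imsetP[i _ ->].
  exact: (leq_bigmax (F := fun i : dtree D => #|bag i|)).
by rewrite leq_mul2r leq_imset_card orbT.
Qed.

(** The node map carries the connected complement of [bag t] onto the tree minus [t], so no node is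
    a cut vertex and there are at most two bags. *)
Lemma cycle_connected_decomp_width n (D : strong_tree_decomp (cycle_graph n)) :
  (forall i : dtree D, connected_in (bag i)) -> n <= 2 * width D.
Proof.
move=> conD; have := partition_width D; rewrite card_ord => /leq_trans; apply.
rewrite leq_mul2r; apply/orP; right; apply: tree_without_cut_vertex (dtreeP D) _ => t.
have [f fP] := decomp_node_map D.
have f_surj i : exists u, f u = i.
  have /and3P[_ _ bag_neq0] := bag_partition D.
  have: bag i != set0 by apply: contraNneq bag_neq0 => <-; apply: imset_f.
  by case/set0Pn => u; rewrite fP => /eqP; exists u.
move=> a b; have [u <-] := f_surj a; have [v <-] := f_surj b.
rewrite !in_setC1 -!fP => ut vt.
pose eG := [rel x y | [&& x \in ~: bag t, y \in ~: bag t & @adj (cycle_graph n) x y]].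
have: connect eG u v by apply: cycle_graph_setC_connected => //; rewrite in_setC.
apply: (@homo_connect _ _ eG _ f) => x y /and3P[]; rewrite !in_setC !fP => xt yt.
case/(@bag_edge _ D) => i [j []]; rewrite !fP => /eqP <- /eqP <- /orP[/eqP-> //|xy].
by apply: connect1; rewrite /= !in_setC1 xt yt.
Qed.

(** * Decompositions from maps onto trees, and the upper bound *)

Section DecompOfMap.

Variables (G T : sgraph) (f : G -> T) (g : T -> G).
Hypotheses (treeT : is_tree T) (gK : cancel g f).
Hypothesis f_adj : forall u v, adj u v -> (f u == f v) || adj (f u) (f v).

Definition fiber (i : T) : {set G} := [set u | f u == i].

(** The section [g] provides a point in each fiber; it yields injectivity here and nonempty parts in
    [fiber_partition]. *)
Lemma fiber_inj : injective fiber.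
Proof. by move=> i j /setP/(_ (g i)); rewrite !inE gK eqxx => /esym/eqP. Qed.

Lemma fiber_partition : partition [set fiber i | i : T] [set: G].
Proof.
apply/and3P; split.
- apply/eqP/setP => u; rewrite inE; apply/bigcupP; exists (fiber (f u)).
    exact: imset_f.
  by rewrite inE.
- apply/trivIsetP => _ _ /imsetP[i _ ->] /imsetP[j _ ->] neq.
  apply/pred0P => u /=; rewrite !inE; apply/negP => /andP[/eqP ui /eqP uj].
  by case/eqP: neq; rewrite -ui -uj.
- by apply/imsetP => -[i _ /setP/(_ (g i))]; rewrite !inE gK eqxx.
Qed.

Lemma fiber_edge u v : adj u v ->
  exists i j, [/\ u \in fiber i, v \in fiber j & (i == j) || adj i j].
Proof. by move=> uv; exists (f u), (f v); rewrite !inE !eqxx; split=> //; apply: f_adj. Qed.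

Definition decomp_of_map : strong_tree_decomp G :=
  StrongTreeDecomp treeT fiber_inj fiber_partition fiber_edge.

End DecompOfMap.

Lemma cycle_has_connected_decomp n : 0 < n ->
  exists D : strong_tree_decomp (cycle_graph n), forall i : dtree D, connected_in (bag i).
Proof.
move=> n_gt0; pose x0 : cycle_graph n := Ordinal n_gt0.
pose f (u : cycle_graph n) : path_graph 1 := ord0.
have gK : cancel (fun=> x0) f by move=> i; rewrite [i]ord1.
have f_adj u v : adj u v -> (f u == f v) || adj (f u) (f v) by rewrite eqxx.
exists (decomp_of_map (path_graph_tree 0) gK f_adj) => i /=.
(* The cycle itself is connected, as the complement of the empty set. *)
have -> : fiber f i = ~: set0 by apply/setP => u; rewrite !inE [i]ord1.
by apply: cycle_graph_setC_connected => u v; rewrite inE.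
Qed.

(** The layer of [u] is its distance [minn u (2 * k - u)] to vertex 0, so layer [i] consists of [i]
    and its mirror image [2 * k - i], taken modulo [2 * k]. *)
Lemma cycle_distance_decomp k : 0 < k ->
  exists (D : strong_tree_decomp (cycle_graph (2 * k))) (r : dtree D),
    [/\ tree_distance r, connected_in (bag r) & width D <= 2].
Proof.
move=> k_gt0.
have layer_lt (u : 'I_(2 * k)) : minn u (2 * k - u) < k.+1 by lia.
pose f (u : cycle_graph (2 * k)) : path_graph k.+1 := Ordinal (layer_lt u).
have node_lt (i : 'I_k.+1) : i < 2 * k by have := ltn_ord i; lia.
pose g (i : path_graph k.+1) : cycle_graph (2 * k) := Ordinal (node_lt i).
have gK : cancel g f.
  by move=> i; apply: val_inj => /=; have := ltn_ord (i : 'I__); lia.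
have f_adj u v : adj u v -> (f u == f v) || adj (f u) (f v).
  rewrite -(inj_eq val_inj) /= /cycle_adj /path_adj /=.
  by have := ltn_ord (u : 'I__); have := ltn_ord (v : 'I__); lia.
exists (decomp_of_map (path_graph_tree k) gK f_adj), ord0; split => /=.
- move=> i /=; rewrite -(inj_eq val_inj) /= => i_neq0.
  have pred_lt : (i : 'I__).-1 < k.+1 by have := ltn_ord (i : 'I__); lia.
  exists (Ordinal pred_lt); first by apply: path_graph_parent => /=; lia.
  move=> v; rewrite !inE => /eqP/(congr1 val) /= vi; have v_lt := ltn_ord (v : 'I__).
  (* The neighbour nearer to 0 is the predecessor on the first half, and the cyclic successor on the
     second. *)
  case: (leqP (v : 'I__) k) => [le_vk|lt_kv].
    have u_lt : (v : 'I__).-1 < 2 * k by lia.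
    exists (Ordinal u_lt : cycle_graph (2 * k)).
      by rewrite inE; apply/eqP/val_inj => /=; lia.
    by rewrite /= /cycle_adj /=; lia.
  have [u uv] : exists u : 'I_(2 * k),
      (u == v.+1 :> nat) || (u == 0 :> nat) && (v.+1 == 2 * k).
    have [last_v|not_last] := eqVneq v.+1 (2 * k).
      by exists (Ordinal (leq_ltn_trans (leq0n _) v_lt)); rewrite orbT.
    have u_lt : v.+1 < 2 * k by rewrite ltn_neqAle not_last.
    by exists (Ordinal u_lt); rewrite eqxx.
  have u_lt := ltn_ord u; exists u; last by rewrite /= /cycle_adj /=; lia.
  by rewrite inE; apply/eqP/val_inj => /=; lia.
- move=> u v; rewrite !inE => /eqP/(congr1 val) /= u0 /eqP/(congr1 val) /= v0.
  suff -> : u = v by apply: connect0.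
  apply: val_inj => /=.
  by have := ltn_ord (u : 'I__); have := ltn_ord (v : 'I__); lia.
(* For [i = 0] the mirror image [2 * k] is out of range, and [insubd] falls back on [g i]. *)
- apply/bigmax_leqP => i _ /=; pose b : 'I_(2 * k) := insubd (g i : 'I__) (2 * k - (i : 'I__)).
  apply: (@leq_trans #|[set g i; b]|); last by rewrite cards2; case: (_ != _).
  apply/subset_leq_card/subsetP => u; rewrite !inE => /eqP/(congr1 val) /= ui.
  rewrite -!(inj_eq val_inj) /= val_insubd /=.
  by case: ifP => ?; have := ltn_ord (u : 'I__); lia.
Qed.

Unset Implicit Arguments.

Theorem theorem8 (k : nat) (hk : 2 <= k) :
  exists G : sgraph,
    (exists2 w, is_ctdw G w & w <= 2) /\ (exists2 w, is_cstw G w & k <= w).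
Proof.
have k_gt0 : 0 < k := ltnW hk.
exists (cycle_graph (2 * k)); split.
  have [D [r [distD conr width_le2]]] := cycle_distance_decomp k_gt0.
  have [w minw lew] : exists2 w, is_ctdw (cycle_graph (2 * k)) w & w <= width D.
    by apply: is_minimum_below; exists D, r.
  by exists w => //; apply: leq_trans lew width_le2.
(* This decomposition only ensures that the minimum exists; the bound is then applied to an optimal
   one, [D']. *)
have [|D conD] := @cycle_has_connected_decomp (2 * k); first by rewrite muln_gt0.
have [w minw _] : exists2 w, is_cstw (cycle_graph (2 * k)) w & w <= width D.
  by apply: is_minimum_below; exists D.
exists w => //; have [[D' [conD' <-]] _] := minw.
by rewrite -(leq_pmul2l (ltn0Sn 1)); apply: cycle_connected_decomp_width.
Qed.
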